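(* Let $\mathbb{T}_1,\mathbb{T}_2$ be time scales, $a_1\in\mathbb{T}_1$, $a_2\in\mathbb{T}_2$, $\tilde{\mathbb{T}}_1=[a_1,\infty)\cap\mathbb{T}_1$, $\tilde{\mathbb{T}}_2=[a_2,\infty)\cap\mathbb{T}_2$. Let $u(t_1,t_2),a(t_1,t_2),f(t_1,t_2)\in C(\tilde{\mathbb{T}}_1\times\tilde{\mathbb{T}}_2,\mathbb{R}_0^+)$ with $a(t_1,t_2)$ nondecreasing in each of the variables. If $$u(t_1,t_2)\le a(t_1,t_2)+\int_{a_1}^{t_1}\int_{a_2}^{t_2}f(s_1,s_2)u(s_1,s_2)\Delta_1s_1\Delta_2s_2$$ for $(t_1,t_2)\in\tilde{\mathbb{T}}_1\times\tilde{\mathbb{T}}_2$, then $$u(t_1,t_2)\le a(t_1,t_2)\,e_{\int_{a_2}^{t_2}f(t_1,s_2)\Delta_2s_2}(t_1,a_1),\quad(t_1,t_2)\in\tilde{\mathbb{T}}_1\times\tilde{\mathbb{T}}_2.$$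
   Context: $\mathbb{R}_0^+=[0,\infty)$. A time scale is a nonempty closed subset of $\mathbb{R}$, with $\sigma(t)=\inf\{s\in\mathbb{T}:s>t\}$, $\mu(t)=\sigma(t)-t$. $y^\Delta(t)$ is the $\Delta$-derivative: for each $\varepsilon>0$, $|y(\sigma(t))-y(s)-y^\Delta(t)(\sigma(t)-s)|\le\varepsilon|\sigma(t)-s|$ for $s$ near $t$. $\int_c^df\Delta t=F(d)-F(c)$ with $F^\Delta=f$; $\Delta_1,\Delta_2$ refer to $\mathbb{T}_1,\mathbb{T}_2$ (with $s_1$ ranging over $[a_1,t_1)$ and $s_2$ over $[a_2,t_2)$). For an rd-continuous function $p$ with $1+\mu(t)p(t)\ne0$, $e_p(\cdot,t_0)$ is the unique solution of $y^\Delta=p(t)y$, $y(t_0)=1$. In the conclusion, for fixed $t_2$, $e_{\int_{a_2}^{t_2}f(t_1,s_2)\Delta_2s_2}(t_1,a_1)$ means $e_p(t_1,a_1)$ on $\mathbb{T}_1$ with $p(\tau)=\int_{a_2}^{t_2}f(\tau,s_2)\Delta_2s_2$. *)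

(* Defs.v *)
From mathcomp Require Import all_boot all_order all_algebra.
From mathcomp Require Import all_classical all_reals all_analysis.
Import Order.TTheory GRing.Theory Num.Theory.
Import numFieldNormedType.Exports.

Set Implicit Arguments.
Unset Strict Implicit.
Unset Printing Implicit Defensive.

Local Open Scope classical_set_scope.
Local Open Scope ring_scope.

Definition time_scale (R : realType) (T : set R) : Prop :=
  T !=set0 /\ closed T.

Definition ts_from (R : realType) (T : set R) (a : R) : set R :=
  `[a, +oo[ `&` T.

(* The usual convention inf set0 = sup T applies, so that the forward jump
   of a maximum of T is that maximum itself. *)
Definition ts_sigma (R : realType) (T : set R) (t : R) : R :=
  let later := [set s | T s /\ t < s] in
  if later == set0 then sup T else inf later.

(* Functions on T are represented by total functions on R of which only the
   values on T matter.  If t is a maximum of T that is isolated in T, then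
   every l satisfies this predicate: quantifying over all points of T in the
   definitions below thus amounts to quantifying over T^kappa. *)
Definition is_delta_derive (R : realType) (T : set R) (y : R -> R) (t l : R) :
    Prop :=
  forall eps : R, 0 < eps ->
    \forall s \near within T (nbhs t),
      `|y (ts_sigma T t) - y s - l * (ts_sigma T t - s)|
        <= eps * `|ts_sigma T t - s|.

(* The value does not depend on the antiderivative chosen by [get], two
   antiderivatives on T differing by a constant on T; it is arbitrary when f
   has no antiderivative on T. *)
Definition delta_int (R : realType) (T : set R) (f : R -> R) (c d : R) : R :=
  let F := get [set F : R -> R | forall t, T t -> is_delta_derive T F t (f t)] in
  F d - F c.

(* For p rd-continuous on T with 1 + mu p nonzero, the solution picked by
   [get] is unique on T. *)
Definition delta_exp (R : realType) (T : set R) (p : R -> R) (t0 : R) : R -> R :=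
  get [set y : R -> R |
    (forall t, T t -> is_delta_derive T y t (p t * y t)) /\ y t0 = 1].

(* Main.v *)
Require Import Defs.
From mathcomp Require Import all_boot all_order all_algebra.
From mathcomp Require Import all_classical all_reals all_analysis.
From mathcomp Require Import ring lra.
Import Order.TTheory GRing.Theory Num.Theory.
Import numFieldNormedType.Exports.

Set Implicit Arguments.
Unset Strict Implicit.
Unset Printing Implicit Defensive.

Local Open Scope classical_set_scope.
Local Open Scope ring_scope.

(** Fix the point (c, b) at which the bound is wanted and put A = a(c, b).
    For t <= c let z(t) be A plus the integral over [a1, t) of
    K(s1) = int_(a2)^b f(s1, s2) u(s1, s2).  Since a is nondecreasing and
    f u >= 0, the hypothesis gives u(t, s2) <= z(t) for all t <= c and
    s2 <= b, hence the Delta-derivative K of z satisfies K <= p z, where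
    p(t) = int_(a2)^b f(t, s2).  Gronwall's inequality in one variable then
    yields z <= A e_p, and the claim is the value at c.

    The integral and the exponential are specified by choice, so they mean
    something only once antiderivatives and solutions of y^Delta = p y are
    known to exist.  Both are constructed here for functions that are locally
    bounded and continuous at right-dense points ([rd_regular]).

    - [antiderivative_exists]: the value at t of the antiderivative of h is the
      supremum of G(t) over the functions G, null at a, whose increment over
      every [x, y) is at most (sup of h over [x, y)) * (y - x).  This avoids
      both Riemann sums and measure theory.
    - [exponential_exists]: the solution is the ordinary exponential of an
      antiderivative of the cylinder transform ln (1 + mu p) / mu of p.

    All comparison results, in particular [delta_le] (monotonicity of the
    integral) and [gronwall_zero], come from one principle, [delta_barrier]:
    a function that is strictly decreasing whenever it is nonpositive cannot
    become positive.  Finally [delta_int_continuous] makes K and p continuous,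
    by equicontinuity of the slices of a continuous function over a compact
    set. *)

(** * Neighbourhoods and the forward jump in a time scale *)

Lemma within_nearP (R : realType) (T : set R) (t : R) (P : R -> Prop) :
  (\forall s \near within T (nbhs t), P s) <->
  exists2 d : R, 0 < d & forall s, T s -> `|t - s| < d -> P s.
Proof.
rewrite near_withinE; split.
  by move=> /nbhs_ballP[d /= d0 H]; exists d => // s Ts ts; apply: H.
by case=> d d0 H; apply/nbhs_ballP; exists d => //= s ts Ts; apply: H.
Qed.

Lemma sigma_max (R : realType) (T : set R) (t : R) : T t ->
  (forall s, T s -> s <= t) -> ts_sigma T t = t.
Proof.
move=> Tt tmax; rewrite /ts_sigma ifT.
  apply/eqP; rewrite eq_le ge_sup//=; last by exists t.
  by apply: ub_le_sup => //; exists t.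
by apply/eqP; rewrite -subset0 => s [/tmax] /le_lt_trans /[apply]; rewrite ltxx.
Qed.

Lemma sigma_le (R : realType) (T : set R) (t s : R) : T s -> t < s ->
  ts_sigma T t <= s.
Proof.
move=> Ts ts; rewrite /ts_sigma; case: ifPn => [/eqP l0|_].
  by have : [set s | T s /\ t < s] s by []; rewrite l0.
by apply: ge_inf => //; exists t => x [_ /ltW].
Qed.

Lemma sigma_ge (R : realType) (T : set R) (t : R) : T t -> t <= ts_sigma T t.
Proof.
move=> Tt; have [/existsNP[s /not_implyP[Ts /negP]]|smax] :=
  pselect (~ forall s, T s -> s <= t).
  rewrite -ltNge => ts; rewrite /ts_sigma ifF; last first.
    by apply/eqP => l0; have : [set s | T s /\ t < s] s by []; rewrite l0.
  by apply: lb_le_inf; [exists s|move=> x [_ /ltW]].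
by rewrite sigma_max //; exact: contrapT smax.
Qed.

Lemma sigma_dense (R : realType) (T : set R) (t s : R) : T t -> T s -> t < s ->
  ts_sigma T t = t ->
  forall d, 0 < d -> exists r, [/\ T r, t < r & r < t + d].
Proof.
move=> Tt Ts ts; rewrite /ts_sigma ifF; last first.
  by apply/eqP => l0; have : [set s | T s /\ t < s] s by []; rewrite l0.
move=> inft d d0.
have [|r [Tr tr]] := @inf_adherent R [set s | T s /\ t < s] d d0.
  by split; [exists s|exists t => x [_ /ltW]].
by rewrite inft => rt; exists r.
Qed.

Lemma closed_inf (R : realType) (T S : set R) : closed T -> S `<=` T ->
  has_inf S -> T (inf S).
Proof.
move=> cT ST [S0 Slb]; apply: cT; apply: (@closure_subset _ S T) => //.
move=> B /nbhs_ballP[e /= e0 eB].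
have [r Sr re] := @inf_adherent R S e e0 (conj S0 Slb).
exists r; split => //; apply: eB; rewrite /ball /= distrC ger0_norm ?subr_ge0.
  by rewrite ltrBlDl.
exact: ge_inf.
Qed.

Lemma closed_sup (R : realType) (T S : set R) : closed T -> S `<=` T ->
  S !=set0 -> has_ubound S -> T (sup S).
Proof.
move=> cT ST S0 Sub; apply: cT; apply: (closure_subset ST).
exact: closure_sup.
Qed.

Lemma sigma_in (R : realType) (T : set R) (t : R) : closed T -> T t ->
  T (ts_sigma T t).
Proof.
move=> cT Tt; have [/existsNP[s /not_implyP[Ts /negP]]|smax] :=
  pselect (~ forall s, T s -> s <= t); last first.
  by rewrite sigma_max //; exact: contrapT smax.
rewrite -ltNge => ts; rewrite /ts_sigma ifF; last first.
  by apply/eqP => l0; have : [set s | T s /\ t < s] s by []; rewrite l0.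
apply: closed_inf => // [x []//|].
by split; [exists s|exists t => x [_ /ltW]].
Qed.

(** * Calculus of Delta-derivatives *)

(** Taking s = t in the definition bounds the defect by eps * mu for every
    eps, so the defect vanishes. *)
Lemma delta_derive_jump (R : realType) (T : set R) (y : R -> R) (t l : R) :
  T t -> is_delta_derive T y t l ->
  y (ts_sigma T t) = y t + l * (ts_sigma T t - t).
Proof.
move=> Tt dy; apply/eqP; rewrite -subr_eq0 -normr_le0.
apply/ler_addgt0Pr => e e0; rewrite add0r.
have st0 : 0 <= ts_sigma T t - t by rewrite subr_ge0 sigma_ge.
have e1 : 0 < e / (ts_sigma T t - t + 1) by apply: divr_gt0; lra.
have /within_nearP[d d0 /(_ t Tt)] := dy _ e1.
rewrite subrr normr0 opprD addrA => /(_ d0) /le_trans; apply.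
rewrite ger0_norm // mulrAC ler_pdivrMr; last by lra.
nra.
Qed.

Lemma delta_derive_continuous (R : realType) (T : set R) (y : R -> R)
    (t l : R) : T t -> is_delta_derive T y t l ->
  y @ within T (nbhs t) --> y t.
Proof.
move=> Tt dy; apply/cvgrPdist_le => e e0; apply/within_nearP.
set m := ts_sigma T t - t.
have m0 : 0 <= m by rewrite subr_ge0 sigma_ge.
have L0 : 0 <= `|l| by [].
set c := e / (m + 1) / 2.
have c0 : 0 < c by rewrite /c !divr_gt0//; lra.
have cm : c * (m + 1) = e / 2 by rewrite /c mulrAC divfK //; lra.
have /within_nearP[d d0 H] := dy _ c0.
exists (Num.min d (Num.min 1 (e / 2 / (`|l| + 1)))).
  by rewrite !lt_min d0 ltr01 !divr_gt0//; lra.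
move=> s Ts; rewrite !lt_min => /and3P[td t1 te].
have := H _ Ts td.
rewrite (delta_derive_jump Tt dy) -/m.
have -> : ts_sigma T t - s = m + (t - s) by rewrite /m; ring.
have lts : `|l * (t - s)| <= e / 2.
  rewrite normrM; move: te; rewrite ltr_pdivlMr; last by lra.
  have : 0 <= `|t - s| by [].
  nra.
have mts : `|m + (t - s)| <= m + 1.
  by rewrite (le_trans (ler_normD _ _))// (ger0_norm m0); lra.
move=> H1.
have {}H1 : `|y t + l * m - y s - l * (m + (t - s))| <= e / 2.
  apply: (le_trans H1); rewrite -cm; nra.
have -> : y t - y s =
  (y t + l * m - y s - l * (m + (t - s))) + l * (t - s) by ring.
by apply: (le_trans (ler_normD _ _)); lra.
Qed.

(** At a right-scattered point the Delta-derivative is a difference quotient,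
    and continuity is all that the definition asks in addition. *)
Lemma delta_derive_scattered (R : realType) (T : set R) (y : R -> R) (t l : R) :
  T t -> t < ts_sigma T t -> y @ within T (nbhs t) --> y t ->
  y (ts_sigma T t) = y t + l * (ts_sigma T t - t) ->
  is_delta_derive T y t l.
Proof.
move=> Tt st cy yS e e0; apply/within_nearP.
set S := ts_sigma T t in st yS *.
have L0 : 0 <= `|l| by [].
have e1 : 0 < e * (S - t) / 2 by rewrite divr_gt0 ?mulr_gt0//; lra.
have /cvgrPdist_le/(_ _ e1)/within_nearP[d d0 H] := cy.
pose d1 := e * (S - t) / 2 / (`|l| + 1).
have d10 : 0 < d1 by rewrite divr_gt0//; lra.
exists (Num.min (S - t) (Num.min d d1)); first by rewrite !lt_min d0 d10; lra.
move=> s Ts; rewrite !lt_min => /and3P[ts1 tsd tsd1].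
have st' : s <= t.
  rewrite leNgt; apply/negP => ts; have := sigma_le Ts ts; rewrite -/S.
  by move: ts1; rewrite ltr0_norm ?subr_lt0//; lra.
have h := H s Ts tsd.
have -> : y S - y s - l * (S - s) = (y t - y s) - l * (t - s).
  by rewrite yS; ring.
have h2 : `|l * (t - s)| <= e * (S - t) / 2.
  rewrite normrM; have : d1 * (`|l| + 1) = e * (S - t) / 2.
    by rewrite /d1 divfK //; lra.
  have : 0 <= `|t - s| by []. nra.
apply: (le_trans (ler_normB _ _)).
rewrite [X in _ <= e * X]gtr0_norm; last by lra. nra.
Qed.

Lemma delta_derive_lin (R : realType) (T : set R) (y z : R -> R) (t l m k : R) :
  is_delta_derive T y t l -> is_delta_derive T z t m ->
  is_delta_derive T (fun s => y s + k * z s) t (l + k * m).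
Proof.
move=> dy dz e e0.
have k1 : 0 < `|k| + 1 by have : 0 <= `|k| by []; lra.
have e1 : 0 < e / 2 by lra.
have e2 : 0 < e / 2 / (`|k| + 1) by rewrite !divr_gt0.
apply: filterS2 (dy _ e1) (dz _ e2) => s.
set S := ts_sigma T t => h1 h2.
have -> : y S + k * z S - (y s + k * z s) - (l + k * m) * (S - s) =
  (y S - y s - l * (S - s)) + k * (z S - z s - m * (S - s)) by ring.
apply: (le_trans (ler_normD _ _)); rewrite normrM.
have ss0 : 0 <= `|S - s| by [].
have h3 : `|k| * `|z S - z s - m * (S - s)| <= e / 2 * `|S - s|.
  apply: (@le_trans _ _ ((`|k| + 1) * (e / 2 / (`|k| + 1) * `|S - s|))).
    apply: ler_pM => //; lra.
  by rewrite mulrA [_ * (_ / _)]mulrC divfK // gt_eqF.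
lra.
Qed.

Lemma delta_derive_affine (R : realType) (T : set R) (t k c : R) :
  is_delta_derive T (fun s => k * s + c) t k.
Proof.
move=> e e0; apply: nearW => s.
rewrite [X in `|X|](_ : _ = 0) ?normr0 ?mulr_ge0 ?normr_ge0 ?ltW//; ring.
Qed.

(** * Comparison principles *)

(** Let t0 be the infimum of the points where w > 0.  It is not such a point
    itself: it would be reached either from the left by continuity, or by a
    jump from a point r where w and w' are both nonpositive.  So t0 is a limit
    from the right of points where w > 0, which w' t0 < 0 forbids. *)
Lemma delta_barrier (R : realType) (T : set R) (w w' : R -> R) (a c : R) :
  closed T -> T a ->
  (forall t, T t -> a <= t <= c -> is_delta_derive T w t (w' t)) ->
  w a <= 0 ->
  (forall t, T t -> a <= t < c -> w t <= 0 -> w' t < 0) ->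
  forall t, T t -> a <= t <= c -> w t <= 0.
Proof.
move=> cT Ta dw wa wlt t1 Tt1 /andP[at1 t1c]; rewrite leNgt; apply/negP => wt1.
pose S := [set t | [/\ T t, a <= t <= c & 0 < w t]].
have St1 : S t1 by split => //; rewrite at1.
have Sinf : has_inf S.
  by split; [exists t1|exists a => x [_ /andP[]]].
set t0 := inf S.
have Tt0 : T t0 by apply: closed_inf => // x [].
have at0 : a <= t0.
  by apply: lb_le_inf; [exists t1|move=> x [_ /andP[]]].
have t0t1 : t0 <= t1 by apply: ge_inf => //; case: Sinf.
have t0c := le_trans t0t1 t1c.
have wle t : T t -> a <= t -> t < t0 -> w t <= 0.
  move=> Tt at_ tt0; rewrite leNgt; apply/negP => wt.
  have : t0 <= t.
    apply: ge_inf; first by case: Sinf.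
    by split=> //; rewrite at_ (le_trans (ltW tt0)).
  by rewrite leNgt tt0.
have dw0 := dw _ Tt0 (introT andP (conj at0 t0c)).
have wt0 : w t0 <= 0.
  rewrite leNgt; apply/negP => wt0.
  have {}at0 : a < t0.
    by rewrite lt_neqAle at0 andbT; apply/eqP => E; move: wa wt0; rewrite E; lra.
  (* The supremum r of the earlier points is t0 or its left neighbour. *)
  pose B := [set t | [/\ T t, a <= t & t < t0]].
  have Ba : B a by [].
  have Bub : has_ubound B by exists t0 => x [_ _ /ltW].
  set r := sup B.
  have Tr : T r by apply: closed_sup => //; [move=> x []|exists a].
  have ar : a <= r by apply: ub_le_sup.
  have : r <= t0 by apply: ge_sup; [exists a|move=> x [_ _ /ltW]].
  rewrite le_eqVlt => /predU1P[rt0|rt0].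
    have /cvgrPdist_lt/(_ _ wt0)/within_nearP[d d0 H] :=
      delta_derive_continuous Tt0 dw0.
    have [s [Ts as_ st0] rs] := sup_adherent d0 (conj (ex_intro _ a Ba) Bub).
    move: rs; rewrite -/r rt0 => rs.
    have := H s Ts; rewrite !ger0_norm; last by lra.
      have := wle s Ts as_ st0; lra.
    have := wle s Ts as_ st0; lra.
  have sr : ts_sigma T r = t0.
    apply/eqP; rewrite eq_le sigma_le//= leNgt; apply/negP => h.
    have Bs : B (ts_sigma T r).
      split => //; first exact: sigma_in.
      exact: le_trans ar (sigma_ge Tr).
    have sr : ts_sigma T r = r.
      by apply/eqP; rewrite eq_le sigma_ge // andbT; exact: ub_le_sup.
    have [q [Tq rq qt0]] := sigma_dense Tr Tt0 rt0 sr
      (ltac:(lra) : 0 < t0 - r).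
    have : q <= r.
      apply: ub_le_sup => //; split => //; first exact: le_trans ar (ltW rq).
      lra.
    lra.
  have rc : a <= r < c by rewrite ar (lt_le_trans rt0).
  have rc' : a <= r <= c by case/andP: rc => -> /ltW ->.
  have := delta_derive_jump Tr (dw _ Tr rc'); rewrite sr.
  have wr := wle _ Tr ar rt0.
  have := wlt _ Tr rc wr.
  nra.
have {}t0t1 : t0 < t1.
  by rewrite lt_neqAle t0t1 andbT; apply/eqP => E; move: wt0 wt1; rewrite E; lra.
have w0 := wlt t0 Tt0 (ltac:(rewrite at0; exact: lt_le_trans t0t1 t1c)) wt0.
have near_bad d : 0 < d -> exists s, [/\ T s, t0 < s, s < t0 + d & 0 < w s].
  move=> d0; have [s [Ts /andP[as_ _] ws] sd] := inf_adherent d0 Sinf.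
  exists s; split => //; rewrite ltNge le_eqVlt.
  apply/negP => /predU1P[E|/(wle _ Ts as_)]; last by lra.
  by move: wt0 ws; rewrite E; lra.
have st0 : ts_sigma T t0 = t0.
  apply/eqP; rewrite eq_le sigma_ge // andbT leNgt; apply/negP => h.
  have [|s [Ts t0s ss _]] := near_bad (ts_sigma T t0 - t0); first by lra.
  have := sigma_le Ts t0s; lra.
have /within_nearP[d d0 H] := dw0 _ (ltac:(lra) : 0 < - w' t0).
have [s [Ts t0s ss ws]] := near_bad _ d0.
have := H s Ts; rewrite st0 distrC (gtr0_norm (_ : 0 < s - t0)); last by lra.
have := ler_norm (- (w t0 - w s - w' t0 * (t0 - s))); rewrite normrN.
set N := `|_| => h1 h2; have {}h2 : N <= - w' t0 * (s - t0) by apply: h2; lra.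
have : w s - w t0 + w' t0 * (t0 - s) <= - w' t0 * (s - t0) by lra.
lra.
Qed.

(** The barrier principle needs a strict inequality, which is gained by
    subtracting e * (t - a) and letting e tend to 0. *)
Lemma delta_nonincreasing (R : realType) (T : set R) (F F' : R -> R) (a c : R) :
  closed T -> T a -> T c -> a <= c ->
  (forall t, T t -> a <= t <= c -> is_delta_derive T F t (F' t)) ->
  (forall t, T t -> a <= t < c -> F' t <= 0) ->
  F c <= F a.
Proof.
move=> cT Ta Tc ac dF F'le.
have key e : 0 < e -> F c + 1 * (- e * c + (e * a - F a)) <= 0.
  move=> e0; apply: (@delta_barrier R T
    (fun s => F s + 1 * (- e * s + (e * a - F a)))
    (fun s => F' s + 1 * - e) a c) => //.
  - by move=> t Tt atc; apply: delta_derive_lin (dF _ Tt atc) _;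
      exact: delta_derive_affine.
  - lra.
  - by move=> t Tt atc _; have := F'le t Tt atc; lra.
  - by rewrite ac lexx.
rewrite leNgt; apply/negP => Fac.
(* The + 1 keeps the denominator positive when c = a. *)
have := key ((F c - F a) / 2 / (c - a + 1)).
have h : 0 < c - a + 1 by lra.
have -> : 0 < (F c - F a) / 2 / (c - a + 1) by rewrite !divr_gt0//; lra.
set e := _ / (c - a + 1) => /(_ isT).
have : e * (c - a + 1) = (F c - F a) / 2 by rewrite /e divfK // gt_eqF.
have : 0 < e by rewrite /e !divr_gt0//; lra.
nra.
Qed.

Lemma delta_le (R : realType) (T : set R) (F F' G G' : R -> R) (a c : R) :
  closed T -> T a -> T c -> a <= c ->
  (forall t, T t -> a <= t <= c -> is_delta_derive T F t (F' t)) ->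
  (forall t, T t -> a <= t <= c -> is_delta_derive T G t (G' t)) ->
  (forall t, T t -> a <= t < c -> F' t <= G' t) ->
  F c - F a <= G c - G a.
Proof.
move=> cT Ta Tc ac dF dG FG.
suff : F c + -1 * G c <= F a + -1 * G a by lra.
apply: (@delta_nonincreasing R T (fun s => F s + -1 * G s)
  (fun s => F' s + -1 * G' s)) => // t Tt atc.
  by apply: delta_derive_lin; [exact: dF|exact: dG].
by have := FG t Tt atc; lra.
Qed.

(** * Existence of antiderivatives *)

(** Rd-continuity without the left limits at left-dense right-scattered points:
    only local boundedness matters there.  Local boundedness is required on
    lower rays since the time scales considered have a least element. *)
Definition rd_regular (R : realType) (T : set R) (h : R -> R) : Prop :=
  (forall c, exists M, forall t, T t -> t <= c -> `|h t| <= M) /\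
  (forall t, T t -> ts_sigma T t = t -> h @ within T (nbhs t) --> h t).

(** The competitors in a Perron-style supremum.  The condition is imposed up to
    b only, so that competitors may be extended beyond b without constraint. *)
Definition sub_integral (R : realType) (T : set R) (h : R -> R) (a b : R)
    (G : R -> R) : Prop :=
  G a = 0 /\ forall x y k, T x -> T y -> x <= y -> y <= b ->
    (forall s, T s -> x <= s < y -> h s <= k) -> G y - G x <= k * (y - x).

(** The increment of F over [x, y) lies between the infimum and the supremum of
    h there, times y - x.  At a right-dense t these bounds close up by
    continuity of h.  At a right-scattered t the interval [t, sigma t) contains
    t alone, so the jump of F is exact; on the left, where h need not be
    continuous at t, boundedness of h makes F continuous, which suffices. *)
Lemma derive_of_mean_value_bounds (R : realType) (T : set R) (h F : R -> R) :
  closed T -> rd_regular T h ->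
  (forall x y k, T x -> T y -> x <= y ->
    (forall s, T s -> x <= s < y -> h s <= k) -> F y - F x <= k * (y - x)) ->
  (forall x y k, T x -> T y -> x <= y ->
    (forall s, T s -> x <= s < y -> k <= h s) -> k * (y - x) <= F y - F x) ->
  forall t, T t -> is_delta_derive T F t (h t).
Proof.
move=> cT [hb hc] Fub Flb t Tt e e0; apply/within_nearP.
have Ts := sigma_in cT Tt; have := sigma_ge Tt.
rewrite le_eqVlt => /predU1P[st|st].
  rewrite -st; have /cvgrPdist_le/(_ _ e0)/within_nearP[d d0 H] := hc t Tt (esym st).
  exists d => // s {}Ts ts.
  have near_t r : T r -> `|t - r| < d -> h t - e <= h r <= h t + e.
    by move=> Tr /(H r Tr); rewrite ler_norml; lra.
  have [tles|slet] := leP t s.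
    rewrite ler0_norm in ts; last by lra.
    have U : F s - F t <= (h t + e) * (s - t).
      apply: Fub => // r Tr rst; have := near_t r Tr.
      rewrite ler0_norm; last by lra. by lra.
    have L : (h t - e) * (s - t) <= F s - F t.
      apply: Flb => // r Tr rst; have := near_t r Tr.
      rewrite ler0_norm; last by lra. by lra.
    rewrite [X in _ <= e * X]ler0_norm; last by lra.
    by rewrite ler_norml; lra.
  rewrite gtr0_norm in ts; last by lra.
  have U : F t - F s <= (h t + e) * (t - s).
    apply: Fub (ltW slet) _ => // r Tr rst; have := near_t r Tr.
    rewrite ger0_norm; last by lra. by lra.
  have L : (h t - e) * (t - s) <= F t - F s.
    apply: Flb (ltW slet) _ => // r Tr rst; have := near_t r Tr.
    rewrite ger0_norm; last by lra. by lra.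
  rewrite [X in _ <= e * X]gtr0_norm; last by lra.
  by rewrite ler_norml; lra.
set S := ts_sigma T t in Ts st *.
have only_t s : T s -> t <= s < S -> s = t.
  move=> {}Ts /andP[]; rewrite le_eqVlt => /predU1P[//|ts sS].
  by have := sigma_le Ts ts; rewrite -/S; lra.
have U : F S - F t <= h t * (S - t).
  by apply: Fub (ltW st) _ => // s {}Ts /(only_t _ Ts) ->.
have L : h t * (S - t) <= F S - F t.
  by apply: Flb (ltW st) _ => // s {}Ts /(only_t _ Ts) ->.
have [M hM] := hb t.
have M0 : 0 <= M by apply: le_trans (hM t Tt (lexx _)).
(* For s in [t - d, t] the error is at most 2 M (t - s) <= e (S - t). *)
pose d := e * (S - t) / (2 * M + 1).
have d0 : 0 < d by rewrite /d divr_gt0 ?mulr_gt0//; lra.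
have dM : d * (2 * M + 1) = e * (S - t) by rewrite /d divfK //; lra.
exists (Num.min (S - t) d); first by rewrite lt_min d0 subr_gt0 st.
move=> s {}Ts; rewrite lt_min => /andP[ts1 ts2].
have st' : s <= t.
  rewrite leNgt; apply/negP => ts; have := sigma_le Ts ts; rewrite -/S.
  by move: ts1; rewrite ltr0_norm ?subr_lt0//; lra.
have hM' r : T r -> s <= r < t -> - M <= h r <= M.
  by move=> Tr /andP[_ /ltW/(hM r Tr)]; rewrite ler_norml.
have U' : F t - F s <= M * (t - s).
  by apply: Fub => // r Tr /(hM' _ Tr)/andP[].
have L' : - M * (t - s) <= F t - F s.
  by apply: Flb => // r Tr /(hM' _ Tr)/andP[].
have := hM t Tt (lexx _); rewrite ler_norml => /andP[h1 h2].
rewrite [X in _ <= e * X]gtr0_norm; last by lra.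
rewrite ger0_norm in ts2; last by lra.
have a1 : d * (2 * M) <= e * (S - t) by nra.
have a2 : (t - s) * (2 * M) <= d * (2 * M) by nra.
have a3 : h t * (t - s) <= M * (t - s) by nra.
have a4 : - M * (t - s) <= h t * (t - s) by nra.
by rewrite ler_norml; apply/andP; split; nra.
Qed.

(** The supremum inherits the upper mean value bound from its competitors.  It
    satisfies the lower one because a competitor on [a, x] can be continued
    with slope k as long as k <= h, and remains a competitor. *)
Lemma antiderivative_exists (R : realType) (T : set R) (h : R -> R) (a : R) :
  closed T -> T a -> (forall t, T t -> a <= t) -> rd_regular T h ->
  exists F : R -> R, forall t, T t -> is_delta_derive T F t (h t).
Proof.
move=> cT Ta amin hreg; have [hb _] := hreg.
pose V t := [set z | exists2 G, sub_integral T h a t G & G t = z].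
have V0 t : T t -> V t !=set0.
  move=> Tt; have [M hM] := hb t.
  exists (- M * t + M * a); exists (fun s => - M * s + M * a) => //.
  split; first by lra.
  move=> x y k Tx Ty; rewrite le_eqVlt => /predU1P[->|xy] yt hk; first by lra.
  have := hk x Tx; rewrite lexx xy => /(_ isT) hxk.
  have := hM x Tx (le_trans (ltW xy) yt); rewrite ler_norml => /andP[h1 _].
  nra.
have Vub t : T t -> has_ubound (V t).
  move=> Tt; have [M hM] := hb t.
  exists (M * (t - a)) => _ [G [Ga0 GP] <-].
  rewrite -[G t]subr0 -Ga0; apply: GP => //; first exact: amin.
  move=> s Ts /andP[_ /ltW st]; exact: le_trans (ler_norm _) (hM s Ts st).
exists (fun t => sup (V t)); apply: derive_of_mean_value_bounds => // x y k Tx Ty xy hk.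
  rewrite lerBlDr; apply: ge_sup; first exact: V0.
  move=> _ [G [Ga0 GP] <-].
  have : G x <= sup (V x).
    apply: ub_le_sup; first exact: Vub.
    exists G => //; split => // u v k' Tu Tv uv vx; apply: GP => //.
    exact: le_trans vx xy.
  have := GP x y k Tx Ty xy (lexx _) hk; lra.
rewrite lerBrDl -lerBrDr; apply: ge_sup; first exact: V0.
move=> _ [G [Ga0 GP] <-]; rewrite lerBrDr.
apply: ub_le_sup; first exact: Vub.
(* Continue G with slope k beyond x. *)
exists (fun s => if s <= x then G s else G x + k * (s - x)); last first.
  case: ifP => // yx; have -> : y = x by apply/eqP; rewrite eq_le yx xy.
  by lra.
split; first by rewrite amin.
move=> w z k' Tw Tz wz zy hk'.
have [zx|xz] := leP z x; first by rewrite (le_trans wz zx); exact: GP.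
have [wx|xw] := leP w x.
  have h1 : G x - G w <= k' * (x - w).
    apply: GP => // s Ts /andP[ws sx]; apply: hk' => //.
    by rewrite ws (lt_trans sx xz).
  have h2 : k <= h x by apply: hk => //; rewrite lexx (lt_le_trans xz zy).
  have h3 : h x <= k' by apply: hk' => //; rewrite wx xz.
  nra.
move: wz; rewrite le_eqVlt => /predU1P[->|wz]; first by lra.
have h2 : k <= h w by apply: hk => //; rewrite (ltW xw) (lt_le_trans wz zy).
have h3 : h w <= k' by apply: hk' => //; rewrite lexx wz.
nra.
Qed.

(** * Existence of the exponential *)

(** Any point just to the right of t bounds the forward jumps of the points on
    its left. *)
Lemma graininess_small (R : realType) (T : set R) (t e : R) : T t ->
  ts_sigma T t = t -> 0 < e ->
  exists2 d, 0 < d & forall s, T s -> `|t - s| < d -> ts_sigma T s - s <= e.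
Proof.
move=> Tt st e0.
have [[r [Tr tr]]|tmax] := pselect (exists r, T r /\ t < r).
  have [q [Tq tq qe]] := sigma_dense Tt Tr tr st (ltac:(lra) : 0 < e / 2).
  exists (Num.min (q - t) (e / 2)); first by rewrite lt_min; lra.
  move=> s Ts; rewrite lt_min !ltr_norml => /andP[/andP[h1 _] /andP[_ h2]].
  have := @sigma_le R T s q Tq; lra.
have {}tmax s : T s -> s <= t.
  by move=> Ts; rewrite leNgt; apply/negP => ts; apply: tmax; exists s.
exists e => // s Ts; have := tmax s Ts; rewrite le_eqVlt => /predU1P[->|sle].
  by rewrite st; lra.
by rewrite ltr_norml => /andP[_ h]; have := sigma_le Tt sle; lra.
Qed.

(** The lower bound on the logarithm is 1 + y <= expR y at y = - ln (1 + x). *)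
Lemma ln1D_bounds (R : realType) (x : R) : 0 <= x ->
  [/\ 0 <= ln (1 + x), ln (1 + x) <= x & x - ln (1 + x) <= x ^+ 2].
Proof.
move=> x0; have x1 : 0 < 1 + x by lra.
split; first by apply: ln_ge0; lra.
  by apply: le_ln1Dx; lra.
have := expR_ge1Dx (- ln (1 + x)); rewrite expRN lnK ?posrE // => h.
have h2 : (1 + - ln (1 + x)) * (1 + x) <= 1.
  by rewrite -ler_pdivlMr // div1r.
have := ln_ge0 (ltac:(lra) : 1 <= 1 + x).
nra.
Qed.

(** Hilger's cylinder transform, chosen so that adding mu * cylinder to a
    logarithm multiplies by 1 + mu p. *)
Definition cylinder (R : realType) (T : set R) (p : R -> R) (t : R) : R :=
  if ts_sigma T t == t then p t
  else ln (1 + (ts_sigma T t - t) * p t) / (ts_sigma T t - t).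

Lemma cylinder_bounds (R : realType) (T : set R) (p : R -> R) (t : R) :
  T t -> 0 <= p t ->
  0 <= cylinder T p t <= p t /\
  p t - cylinder T p t <= (ts_sigma T t - t) * p t ^+ 2.
Proof.
move=> Tt p0; rewrite /cylinder; case: eqP => [->|/eqP st].
  by split; [lra|nra].
have m0 : 0 < ts_sigma T t - t by rewrite subr_gt0 lt_neqAle eq_sym st sigma_ge.
set m := _ - t in m0 *; have [|h1 h2 h3] := @ln1D_bounds R (m * p t).
  by nra.
split; first by rewrite divr_ge0 ?(ltW m0)//= ler_pdivrMr // [leRHS]mulrC.
rewrite -(ler_pM2r m0) mulrBl divfK ?gt_eqF //; nra.
Qed.

(** Near a right-dense point the graininess is small, so that the cylinder
    transform differs little from p. *)
Lemma cylinder_regular (R : realType) (T : set R) (p : R -> R) :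
  rd_regular T p -> (forall t, T t -> 0 <= p t) ->
  rd_regular T (cylinder T p).
Proof.
move=> [pb pc] p0; split.
  move=> c; have [M hM] := pb c; exists M => t Tt tc.
  have [/andP[h1 h2] _] := cylinder_bounds Tt (p0 t Tt).
  rewrite ger0_norm // (le_trans h2) // (le_trans _ (hM t Tt tc)) //.
  exact: ler_norm.
move=> t Tt st; apply/cvgrPdist_le => e e0; apply/within_nearP.
have [M hM] := pb (t + 1).
have M0 : 0 <= M by apply: le_trans (normr_ge0 _) (hM t Tt _); lra.
have e2 : 0 < e / 2 by lra.
have M2 : 0 <= M ^+ 2 by rewrite sqr_ge0.
have e3 : 0 < e / 2 / (M ^+ 2 + 1) by rewrite divr_gt0//; lra.
have /cvgrPdist_le/(_ _ e2)/within_nearP[d d0 H] := pc t Tt st.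
have [d' d'0 H'] := graininess_small Tt st e3.
exists (Num.min 1 (Num.min d d')); first by rewrite !lt_min ltr01 d0.
move=> s Ts; rewrite !lt_min => /and3P[ts1 tsd tsd'].
have -> : cylinder T p t = p t by rewrite /cylinder st eqxx.
have [/andP[h1 h2] h3] := cylinder_bounds Ts (p0 s Ts).
have h4 := H _ Ts tsd; have h5 := H' _ Ts tsd'.
have sM : p s <= M.
  apply: le_trans (ler_norm _) (hM s Ts _).
  by move: ts1; rewrite ltr_norml; lra.
have h6 : p s - cylinder T p s <= e / 2.
  apply: (le_trans h3).
  have : e / 2 / (M ^+ 2 + 1) * (M ^+ 2 + 1) = e / 2 by rewrite divfK //; lra.
  have : p s ^+ 2 <= M ^+ 2 by have := p0 s Ts; nra.
  have : 0 <= p s ^+ 2 by nra.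
  have := sigma_ge Ts; nra.
have -> : p t - cylinder T p s = (p t - p s) + (p s - cylinder T p s) by ring.
apply: (le_trans (ler_normD _ _)).
by rewrite (ger0_norm (_ : 0 <= p s - _)); lra.
Qed.

(** Follows from 1 + x <= expR x and expR x * (1 - x) <= expR x * expR (- x). *)
Lemma expR_taylor1 (R : realType) (x : R) : `|x| <= 1 / 2 ->
  `|expR x - 1 - x| <= 2 * x ^+ 2.
Proof.
rewrite ler_norml => /andP[h1 h2].
have h3 := expR_ge1Dx x; have h4 := expR_ge1Dx (- x).
have h5 : expR x * expR (- x) = 1 by rewrite expRN divff // gt_eqF ?expR_gt0.
have h6 := expR_gt0 x.
have h7 : expR x * (1 - x) <= 1 by nra.
rewrite ger0_norm; last by lra. nra.
Qed.

(** The chain rule fails on time scales in general; it holds at a right-dense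
    point, where the Delta-derivative is an ordinary derivative along T. *)
Lemma delta_derive_expR_dense (R : realType) (T : set R) (L : R -> R) (t l : R) :
  T t -> ts_sigma T t = t -> is_delta_derive T L t l ->
  is_delta_derive T (fun s => expR (L s)) t (l * expR (L t)).
Proof.
move=> Tt st dL e e0; apply/within_nearP; rewrite st.
have Y0 := expR_gt0 (L t); set Y := expR (L t) in Y0 *.
pose e' := Num.min 1 (e / 2 / Y).
have e'0 : 0 < e' by rewrite lt_min ltr01 !divr_gt0//; lra.
have e'1 : e' <= 1 by rewrite ge_min lexx.
have e'Y : Y * e' <= e / 2.
  by rewrite mulrC -ler_pdivlMr // ge_min lexx orbT.
have /within_nearP[d d0 H] := dL _ e'0.
have l0 : 0 <= `|l| by [].
pose K := `|l| + 1.
have K0 : 0 < K by rewrite /K; lra.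
have K2 : 0 < 2 * K ^+ 2 by nra.
exists (Num.min d (Num.min (1 / 2 / K) (e' / (2 * K ^+ 2)))).
  by rewrite !lt_min d0 !divr_gt0//; lra.
move=> s Ts; rewrite !lt_min !ltr_pdivlMr// => /and3P[tsd ts1 ts2].
have := H s Ts tsd; rewrite st.
set x := L s - L t; have -> : L t - L s = - x by rewrite /x; ring.
have n0 : 0 <= `|t - s| by [].
move=> h1; have xK : `|x| <= K * `|t - s|.
  have -> : x = - (- x - l * (t - s)) - l * (t - s) by ring.
  apply: (le_trans (ler_normB _ _)); rewrite normrN normrM /K; nra.
have x2 : x ^+ 2 = `|x| ^+ 2 by rewrite real_normK ?num_real.
have nx0 : 0 <= `|x| by [].
have h2 := @expR_taylor1 R x (ltac:(lra)).
have h3 : 2 * x ^+ 2 <= e' * `|t - s|.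
  rewrite x2; have : `|x| ^+ 2 <= (K * `|t - s|) ^+ 2 by nra.
  nra.
have -> : expR (L s) = Y * expR x by rewrite /Y -expRD /x; congr expR; ring.
have -> : Y - Y * expR x - l * Y * (t - s) =
  Y * ((- x - l * (t - s)) - (expR x - 1 - x)) by ring.
rewrite normrM gtr0_norm //.
apply: (@le_trans _ _ (Y * (2 * (e' * `|t - s|)))).
  by rewrite ler_pM2l //; apply: (le_trans (ler_normB _ _)); lra.
nra.
Qed.

Lemma exponential_exists (R : realType) (T : set R) (p : R -> R) (a : R) :
  closed T -> T a -> (forall t, T t -> a <= t) -> rd_regular T p ->
  (forall t, T t -> 0 <= p t) ->
  exists y : R -> R,
    [/\ forall t, T t -> is_delta_derive T y t (p t * y t), y a = 1 &
        forall t, 0 < y t].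
Proof.
move=> cT Ta amin preg p0.
have [L dL] := antiderivative_exists cT Ta amin (cylinder_regular preg p0).
exists (fun t => expR (L t + -1 * (0 * t + L a))); split; last 2 first.
- by rewrite [X in expR X](_ : _ = 0) ?expR0 //; ring.
- by move=> t; exact: expR_gt0.
move=> t Tt.
have {}dL : is_delta_derive T (fun t => L t + -1 * (0 * t + L a)) t
    (cylinder T p t).
  have -> : cylinder T p t = cylinder T p t + -1 * 0 by ring.
  by apply: delta_derive_lin (dL t Tt) _; exact: delta_derive_affine.
have := sigma_ge Tt; rewrite le_eqVlt => /predU1P[st|st].
  apply: delta_derive_expR_dense => //.
  by move: dL; rewrite /cylinder -st eqxx.
apply: delta_derive_scattered => //.
  apply: (@continuous_cvg _ _ _ _ _ _ (expR : R -> R)).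
    exact: continuous_expR.
  exact: delta_derive_continuous Tt dL.
rewrite (delta_derive_jump Tt dL) expRD /cylinder gt_eqF // divfK; last first.
  by rewrite gt_eqF // subr_gt0.
rewrite lnK ?posrE; first by ring.
have := p0 t Tt; nra.
Qed.

(** Subtracting e times the exponential E of p + 1 makes the inequality strict:
    w = v - e E satisfies w' <= p w - e E < 0 wherever w <= 0. *)
Lemma gronwall_zero (R : realType) (T : set R) (p v v' : R -> R) (a c : R) :
  closed T -> T a -> (forall t, T t -> a <= t) -> rd_regular T p ->
  (forall t, T t -> 0 <= p t) ->
  (forall t, T t -> a <= t <= c -> is_delta_derive T v t (v' t)) ->
  v a <= 0 ->
  (forall t, T t -> a <= t < c -> v' t <= p t * v t) ->
  forall t, T t -> a <= t <= c -> v t <= 0.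
Proof.
move=> cT Ta amin [pb pc] p0 dv va vle t Tt atc.
have [||E [dE Ea E0]] := @exponential_exists R T (fun t => p t + 1) a cT Ta amin.
- split.
    move=> b; have [M hM] := pb b; exists (M + 1) => s Ts sb.
    by rewrite (le_trans (ler_normD _ _))// normr1 lerD2r hM.
  by move=> s Ts st; apply: cvgD; [exact: pc|exact: cvg_cst].
- by move=> s /p0; lra.
have key e : 0 < e -> v t + - e * E t <= 0.
  move=> e0; apply: (@delta_barrier R T (fun s => v s + - e * E s)
    (fun s => v' s + - e * ((p s + 1) * E s)) a c) => //.
  - by move=> s Ts asc; apply: delta_derive_lin; [exact: dv|exact: dE].
  - by rewrite Ea; lra.
  - move=> s Ts asc ws; have := vle s Ts asc; have := p0 s Ts; have := E0 s.
    have : 0 < e * E s by rewrite mulr_gt0.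
    nra.
apply/ler_addgt0Pr => e e0; have := key (e / E t).
rewrite divr_gt0 // mulNr divfK ?gt_eqF // => /(_ isT); lra.
Qed.

(** * Continuous functions on a product of time scales *)

Lemma within_prod_near (R : realType) (A B : set R) (s y : R) (P : R * R -> Prop) :
  (\forall z \near within (A `*` B) (nbhs (s, y)), P z) ->
  exists2 d : R, 0 < d & forall s' y', A s' -> B y' ->
    `|s - s'| < d -> `|y - y'| < d -> P (s', y').
Proof.
rewrite near_withinE => /nbhs_ballP[d /= d0 H].
by exists d => // s' y' As By sd yd; apply: H.
Qed.

Lemma slice_continuous (R : realType) (A B : set R) (k : R * R -> R) (s : R) :
  {within A `*` B, continuous k} -> A s ->
  {within B, continuous (fun y => k (s, y))}.
Proof.
move=> /subspace_continuousP ck As; apply/subspace_continuousP => y By.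
apply/cvgrPdist_le => e e0; apply/within_nearP.
have /cvgrPdist_le/(_ _ e0)/within_prod_near[d d0 H] := ck (s, y) (conj As By).
by exists d => // y' By'; apply: H; rewrite // subrr normr0.
Qed.

Lemma slice_equicontinuous (R : realType) (A B K : set R) (k : R * R -> R)
    (t e : R) :
  {within A `*` B, continuous k} -> compact K -> K `<=` B -> A t -> 0 < e ->
  exists2 d, 0 < d & forall s, A s -> `|t - s| < d ->
    forall y, K y -> `|k (t, y) - k (s, y)| <= e.
Proof.
move=> /subspace_continuousP ck /compact_near_coveringP cK KB At e0.
have e2 : 0 < e / 2 by lra.
apply/within_nearP.
suff : \forall s \near within A (nbhs t),
    K `<=` (fun y => K y -> `|k (t, y) - k (s, y)| <= e).
  by apply: filterS => s H y Ky; apply: H.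
apply: cK => y Ky.
have /cvgrPdist_le/(_ _ e2)/within_prod_near[d d0 H] :=
  ck (t, y) (conj At (KB _ Ky)).
exists (ball y d, (fun s => A s /\ `|t - s| < d)) => /=.
  split; first exact: nbhsx_ballx.
  by apply/within_nearP; exists d.
move=> [y' s] /= [yy' [As ts]] Ky'.
have h1 := H t y' At (KB _ Ky') (ltac:(by rewrite subrr normr0)) yy'.
have h2 := H s y' As (KB _ Ky') ts yy'.
have -> : k (t, y') - k (s, y') =
  (k (t, y) - k (s, y')) - (k (t, y) - k (t, y')) by ring.
by apply: (le_trans (ler_normB _ _)); lra.
Qed.

Lemma continuous_rd_regular (R : realType) (T : set R) (h : R -> R) (a : R) :
  closed T -> (forall t, T t -> a <= t) -> {within T, continuous h} ->
  rd_regular T h.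
Proof.
move=> cT amin ch; split; last first.
  by move=> t Tt _; move/subspace_continuousP: ch; apply.
move=> c; have cK : compact (`[a, c] `&` T).
  by apply: compact_closedI => //; exact: segment_compact.
have /compact_bounded[M [_ HM]] := continuous_compact
  (continuous_subspaceW (@subIsetr _ _ _) ch) cK.
exists (M + 1) => t Tt tc; apply: (HM (M + 1)); first by lra.
by exists t => //; split => //=; rewrite in_itv /= amin.
Qed.

(** * The Delta-integral and the exponential function *)

(** The antiderivative does not depend on the bounds of integration, so that
    integrals over different intervals can be compared. *)
Lemma delta_int_antiderivative (R : realType) (T : set R) (h : R -> R) (a : R) :
  closed T -> T a -> (forall t, T t -> a <= t) -> rd_regular T h ->
  exists2 F : R -> R, (forall t, T t -> is_delta_derive T F t (h t)) &
    forall c d, delta_int T h c d = F d - F c.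
Proof.
move=> cT Ta amin hreg.
pose P := [set F : R -> R | forall t, T t -> is_delta_derive T F t (h t)].
exists (get P) => //.
exact: (@getPex _ P (antiderivative_exists cT Ta amin hreg)).
Qed.

(** Both the scaling by k and the offset e are used: the first to bound the
    integral of f u by a multiple of that of f, the second for continuity in a
    parameter. *)
Lemma delta_int_le_affine (R : realType) (T : set R) (h g : R -> R)
    (a b k e : R) :
  closed T -> T a -> (forall t, T t -> a <= t) -> T b ->
  rd_regular T h -> rd_regular T g ->
  (forall t, T t -> t < b -> h t <= k * g t + e) ->
  delta_int T h a b <= k * delta_int T g a b + e * (b - a).
Proof.
move=> cT Ta amin Tb rh rg hg.
have [H dH ->] := delta_int_antiderivative cT Ta amin rh.
have [G dG ->] := delta_int_antiderivative cT Ta amin rg.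
have : H b - H a <= (e * b + 0 + k * G b) - (e * a + 0 + k * G a).
  apply: (@delta_le R T H h (fun s => e * s + 0 + k * G s)
    (fun s => e + k * g s)) => //.
  - exact: amin.
  - by move=> t Tt _; exact: dH.
  - move=> t Tt _; apply: delta_derive_lin (dG t Tt).
    exact: delta_derive_affine.
  - by move=> t Tt /andP[_ tb]; rewrite addrC; exact: hg.
lra.
Qed.

Lemma delta_int_le (R : realType) (T : set R) (h g : R -> R) (a b : R) :
  closed T -> T a -> (forall t, T t -> a <= t) -> T b ->
  rd_regular T h -> rd_regular T g ->
  (forall t, T t -> t < b -> h t <= g t) ->
  delta_int T h a b <= delta_int T g a b.
Proof.
move=> cT Ta amin Tb rh rg hg.
have := @delta_int_le_affine R T h g a b 1 0 cT Ta amin Tb rh rg.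
rewrite !mul1r mul0r addr0; apply => t Tt tb; rewrite mul1r addr0.
exact: hg.
Qed.

Lemma delta_int_nondecreasing (R : realType) (T : set R) (h : R -> R)
    (a c d : R) :
  closed T -> T a -> (forall t, T t -> a <= t) -> T c -> T d -> c <= d ->
  rd_regular T h -> (forall t, T t -> 0 <= h t) ->
  delta_int T h a c <= delta_int T h a d.
Proof.
move=> cT Ta amin Tc Td cd rh h0.
have [H dH H_int] := delta_int_antiderivative cT Ta amin rh; rewrite !H_int.
suff : (0 * d + 0) - (0 * c + 0) <= H d - H c by lra.
apply: (@delta_le R T (fun s => 0 * s + 0) (fun=> 0) H h) => //.
- by move=> t _ _; exact: delta_derive_affine.
- by move=> t Tt _; exact: dH.
- by move=> t Tt _; exact: h0.
Qed.

(** Over [a, b] two close slices of k differ by at most e / (b - a + 1), where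
    the + 1 covers the case b = a. *)
Lemma delta_int_continuous (R : realType) (T1 T2 : set R) (k : R * R -> R)
    (a b : R) :
  closed T2 -> T2 a -> (forall t, T2 t -> a <= t) -> T2 b ->
  {within T1 `*` T2, continuous k} ->
  {within T1, continuous (fun s => delta_int T2 (fun y => k (s, y)) a b)}.
Proof.
move=> cT Ta amin Tb ck; apply/subspace_continuousP => t Tt.
apply/cvgrPdist_le => e e0; apply/within_nearP.
have ab : a <= b by exact: amin.
have e1 : 0 < e / (b - a + 1) by rewrite divr_gt0 //; lra.
have cK : compact (`[a, b] `&` T2).
  by apply: compact_closedI => //; exact: segment_compact.
have [d d0 H] := slice_equicontinuous ck cK (@subIsetr _ _ _) Tt e1.
exists d => // s Ts ts.
have rk r : T1 r -> rd_regular T2 (fun y => k (r, y)).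
  move=> Tr; apply: continuous_rd_regular cT amin _.
  exact: slice_continuous ck Tr.
have {}H y : T2 y -> y < b ->
    - (e / (b - a + 1)) <= k (t, y) - k (s, y) <= e / (b - a + 1).
  move=> Ty yb; rewrite -ler_norml; apply: H => //; split => //=.
  by rewrite in_itv /= amin // ltW.
have h1 := @delta_int_le_affine R T2 _ _ a b 1 (e / (b - a + 1))
  cT Ta amin Tb (rk t Tt) (rk s Ts)
  (fun y Ty yb => ltac:(have := H y Ty yb; lra)).
have h2 := @delta_int_le_affine R T2 _ _ a b 1 (e / (b - a + 1))
  cT Ta amin Tb (rk s Ts) (rk t Tt)
  (fun y Ty yb => ltac:(have := H y Ty yb; lra)).
have h3 : e / (b - a + 1) * (b - a) <= e.
  have : e / (b - a + 1) * (b - a + 1) = e by rewrite divfK // gt_eqF //; lra.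
  lra.
move: h1 h2; set I := delta_int _ _ _ _; set J := delta_int _ _ _ _ => h1 h2.
by rewrite -[X in `|X|]/(I - J) ler_norml; lra.
Qed.

Lemma delta_exp_spec (R : realType) (T : set R) (p : R -> R) (a : R) :
  closed T -> T a -> (forall t, T t -> a <= t) -> rd_regular T p ->
  (forall t, T t -> 0 <= p t) ->
  (forall t, T t -> is_delta_derive T (delta_exp T p a) t
    (p t * delta_exp T p a t)) /\ delta_exp T p a a = 1.
Proof.
move=> cT Ta amin rp p0.
have [y [dy ya _]] := exponential_exists cT Ta amin rp p0.
exact: (@getPex _ [set y : R -> R |
  (forall t, T t -> is_delta_derive T y t (p t * y t)) /\ y a = 1]
  (ex_intro _ y (conj dy ya))).
Qed.

(** * The inequality in two variables *)

Lemma ts_from_closed (R : realType) (T : set R) (a : R) :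
  time_scale T -> closed (ts_from T a).
Proof.
by move=> [_ cT]; apply: closedI => //; exact: rray_closed.
Qed.

Lemma ts_from_ge (R : realType) (T : set R) (a t : R) : ts_from T a t -> a <= t.
Proof. by case; rewrite /= in_itv /= andbT. Qed.

Lemma ts_from_base (R : realType) (T : set R) (a : R) : T a -> ts_from T a a.
Proof. by move=> Ta; split => //=; rewrite in_itv /= lexx. Qed.

Theorem theorem124 (R : realType) (T1 T2 : set R) (a1 a2 : R)
    (u a f : R * R -> R)
    (hT1 : time_scale T1) (hT2 : time_scale T2) (ha1 : T1 a1) (ha2 : T2 a2)
    (cu : {within ts_from T1 a1 `*` ts_from T2 a2, continuous u})
    (ca : {within ts_from T1 a1 `*` ts_from T2 a2, continuous a})
    (cf : {within ts_from T1 a1 `*` ts_from T2 a2, continuous f})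
    (u_ge0 : forall t1 t2, ts_from T1 a1 t1 -> ts_from T2 a2 t2 ->
      0 <= u (t1, t2))
    (a_ge0 : forall t1 t2, ts_from T1 a1 t1 -> ts_from T2 a2 t2 ->
      0 <= a (t1, t2))
    (f_ge0 : forall t1 t2, ts_from T1 a1 t1 -> ts_from T2 a2 t2 ->
      0 <= f (t1, t2))
    (a_nd1 : forall t1 t1' t2, ts_from T1 a1 t1 -> ts_from T1 a1 t1' ->
      ts_from T2 a2 t2 -> t1 <= t1' -> a (t1, t2) <= a (t1', t2))
    (a_nd2 : forall t1 t2 t2', ts_from T1 a1 t1 -> ts_from T2 a2 t2 ->
      ts_from T2 a2 t2' -> t2 <= t2' -> a (t1, t2) <= a (t1, t2'))
    (hu : forall t1 t2, ts_from T1 a1 t1 -> ts_from T2 a2 t2 ->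
      u (t1, t2) <= a (t1, t2) +
        delta_int (ts_from T1 a1)
          (fun s1 => delta_int (ts_from T2 a2)
            (fun s2 => f (s1, s2) * u (s1, s2)) a2 t2) a1 t1) :
  forall t1 t2, ts_from T1 a1 t1 -> ts_from T2 a2 t2 ->
    u (t1, t2) <= a (t1, t2) *
      delta_exp (ts_from T1 a1)
        (fun tau => delta_int (ts_from T2 a2) (fun s2 => f (tau, s2)) a2 t2)
        a1 t1.
Proof.
have cl1 := ts_from_closed (a := a1) hT1.
have cl2 := ts_from_closed (a := a2) hT2.
have in1 := ts_from_base ha1; have in2 := ts_from_base ha2.
have ge1 := @ts_from_ge R T1 a1; have ge2 := @ts_from_ge R T2 a2.
(* From here on the two half-lines are just closed sets with a least element. *)
move: (ts_from T1 a1) (ts_from T2 a2) cl1 cl2 in1 in2 ge1 ge2 cu ca cf u_ge0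
  a_ge0 f_ge0 a_nd1 a_nd2 hu => {hT1 hT2 ha1 ha2 T1 T2} T1 T2 cT1 cT2 Ta1 Ta2
  min1 min2 cu ca cf u_ge0 a_ge0 f_ge0 a_nd1 a_nd2 hu c b Tc Tb.
set k := fun z => f z * u z.
have ck : {within T1 `*` T2, continuous k}.
  apply/subspace_continuousP => z Tz.
  by apply: cvgM; [move/subspace_continuousP: cf|move/subspace_continuousP: cu];
    apply.
have rk s : T1 s -> rd_regular T2 (fun y => k (s, y)).
  by move=> Ts; apply: continuous_rd_regular cT2 min2 (slice_continuous ck Ts).
have rf s : T1 s -> rd_regular T2 (fun y => f (s, y)).
  by move=> Ts; apply: continuous_rd_regular cT2 min2 (slice_continuous cf Ts).
have k_ge0 s y : T1 s -> T2 y -> 0 <= k (s, y).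
  by move=> Ts Ty; rewrite mulr_ge0 ?f_ge0 ?u_ge0.
pose K y s := delta_int T2 (fun s2 => k (s, s2)) a2 y.
have rK y : T2 y -> rd_regular T1 (K y).
  move=> Ty; apply: continuous_rd_regular cT1 min1 _.
  exact: delta_int_continuous.
pose p s := delta_int T2 (fun s2 => f (s, s2)) a2 b.
have rp : rd_regular T1 p.
  apply: continuous_rd_regular cT1 min1 _; exact: delta_int_continuous.
have p_ge0 s : T1 s -> 0 <= p s.
  move=> Ts; have <- : delta_int T2 (fun s2 => f (s, s2)) a2 a2 = 0.
    exact: subrr.
  apply: delta_int_nondecreasing => //; [exact: min2|exact: rf|].
  by move=> t Tt; exact: f_ge0.
have [Z dZ Zint] := delta_int_antiderivative cT1 Ta1 min1 (rK b Tb).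
have [dy ya] := delta_exp_spec cT1 Ta1 min1 rp p_ge0.
set y := delta_exp T1 p a1 in dy ya *.
set A := a (c, b).
pose z t := A + (Z t - Z a1).
have u_le_z t s : T1 t -> T2 s -> t <= c -> s <= b -> u (t, s) <= z t.
  move=> Tt Ts tc sb; apply: le_trans (hu t s Tt Ts) _; apply: lerD.
    by apply: le_trans (a_nd1 _ _ _ Tt Tc Ts tc) (a_nd2 _ _ _ Tc Ts Tb sb).
  rewrite -Zint; apply: delta_int_le => //; [exact: (rK s)|exact: rK|].
  move=> r Tr _; apply: delta_int_nondecreasing => //; first exact: rk.
  by move=> q Tq; exact: k_ge0.
have K_le t : T1 t -> t <= c -> K b t <= z t * p t.
  move=> Tt tc; rewrite -[leRHS]addr0 -(mul0r (b - a2)).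
  apply: delta_int_le_affine => //; [exact: rk|exact: rf|].
  move=> s Ts sb; rewrite addr0 mulrC ler_wpM2l ?f_ge0 //.
  by apply: u_le_z => //; exact: ltW.
have zy : 0 * c + (A - Z a1) + 1 * Z c + - A * y c <= 0.
  apply: (@gronwall_zero R T1 p
    (fun t => 0 * t + (A - Z a1) + 1 * Z t + - A * y t)
    (fun t => 0 + 1 * K b t + - A * (p t * y t)) a1 c) => //.
  - move=> t Tt _; apply: delta_derive_lin (dy t Tt).
    by apply: delta_derive_lin (dZ t Tt); exact: delta_derive_affine.
  - by rewrite ya; lra.
  - move=> t Tt /andP[_ /ltW tc]; have := K_le t Tt tc; rewrite /z; lra.
  - by rewrite min1 // lexx.
have := u_le_z c b Tc Tb (lexx _) (lexx _); rewrite /z; lra.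
Qed.
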